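(* Let $(\mathfrak g,[\cdot,\cdot,\cdot],\alpha)$ be a $3$-Hom-Lie algebra with bracket $\pi$ and let $(V;\rho,\nu,A)$ be a generalized representation of $\mathfrak g$. For $p\ge 0$ let $d:\widetilde C^{p}_{\alpha+A,A}(\mathfrak g\oplus V,V)\to\widetilde C^{p+1}_{\alpha+A,A}(\mathfrak g\oplus V,V)$ be given by $d(\varphi)=[\pi+\overline\rho+\overline\nu,\varphi]^{3HL}$. Then $d\circ d=0$. Thus one obtains a cochain complex whose space of $p$-Hom-cochains ($p\ge1$) is $\widetilde C^{p-1}_{\alpha+A,A}(\mathfrak g\oplus V,V)$.
   Context: All vector spaces are over a field $\mathbb{K}$ of characteristic $0$; $\mathfrak{gl}(V)=\mathrm{End}(V)$. A $3$-Hom-Lie algebra is a triple $(\mathfrak{g},[\cdot,\cdot,\cdot],\alpha)$: a vector space, a trilinear skew-symmetric bracket, and a linear map $\alpha$ with $\alpha[x,y,z]=[\alpha(x),\alpha(y),\alpha(z)]$, satisfying $[\alpha(u),\alpha(v),[x,y,z]]=[[u,v,x],\alpha(y),\alpha(z)]+[\alpha(x),[u,v,y],\alpha(z)]+[\alpha(x),\alpha(y),[u,v,z]]$ for all $x,y,z,u,v$. Graded bracket. Let $W$ be a vector space and $\gamma:W\to W$ linear; write $\gamma(x\wedge y)=\gamma(x)\wedge\gamma(y)$ on $\wedge^2W$. For $p\ge0$, $C^p_{\gamma,\gamma}(W,W)$ is the space of linear maps $\varphi:(\wedge^2W)^{\otimes p}\otimes W\to W$ which, if $p\ge1$, are skew-symmetric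 in the last three arguments (the two entries of the last bivector and the final vector), and satisfy $\gamma(\varphi(X_1,\dots,X_p,x))=\varphi(\gamma(X_1),\dots,\gamma(X_p),\gamma(x))$. For $\varphi\in C^q_{\gamma,\gamma}(W,W)$, $\psi\in C^p_{\gamma,\gamma}(W,W)$, define $\varphi\circ_\gamma\psi\in C^{p+q}_{\gamma,\gamma}(W,W)$ by $$(\varphi\circ_\gamma\psi)(X_1,\dots,X_{p+q},x)=\sum_{J}\ \sum_{k:\,j_p<i_{k+1}}(-1)^{(J,I)}\varphi\big(\gamma^pX_{i_1},\dots,\gamma^pX_{i_k},\psi(X_{j_1},\dots,X_{j_p},\ )\bullet X_{i_{k+1}},\gamma^pX_{i_{k+2}},\dots,\gamma^pX_{i_q},\gamma^p x\big)$$ $$+\sum_J(-1)^{(J,I)}\varphi\big(\gamma^pX_{i_1},\dots,\gamma^pX_{i_q},\psi(X_{j_1},\dots,X_{j_p},x)\big),$$ where $J=\{j_1<\dots<j_p\}$ runs over $p$-element subsets of $N=\{1,\dots,p+q\}$, $I=\{i_1<\dots<i_q\}=N\setminus J$, $(-1)^{(J,I)}$ is the sign of the permutation $(j_1,\dots,j_p,i_1,\dots,i_q)$, $k$ runs over $0\le k\le q-1$ with $j_p<i_{k+1}$ (no condition if $p=0$), and for $X=x\wedge y$, $\psi(X_J,\ )\bullet X=\psi(X_J,x)\wedge\gamma^p(y)+\gamma^p(x)\wedge\psi(X_J,y)$. Put $[\varphi,\psi]^{3HL}=(-1)^{pq}\varphi\circ_\gamma\psi-\psi\circ_\gamma\varphi$.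 Generalized representation. For $A\in\mathfrak{gl}(V)$ and linear maps $\rho:\wedge^2\mathfrak g\to\mathfrak{gl}(V)$, $\nu:\mathfrak g\to\mathrm{Hom}(\wedge^2V,V)$, let $\overline\rho(x+u,y+v,z+w)=\rho(x,y)(w)+\rho(y,z)(u)+\rho(z,x)(v)$ and $\overline\nu(x+u,y+v,z+w)=\nu(x)(v\wedge w)+\nu(y)(w\wedge u)+\nu(z)(u\wedge v)$, and extend $\pi$ by zero to $\wedge^3(\mathfrak g\oplus V)$. Take $W=\mathfrak g\oplus V$ and $\gamma=\alpha+A$, where $(\alpha+A)(x+u)=\alpha(x)+A(u)$. Then $(V;\rho,\nu,A)$ is a generalized representation if $\pi+\overline\rho+\overline\nu\in C^1_{\gamma,\gamma}(W,W)$ and $[\pi+\overline\rho+\overline\nu,\pi+\overline\rho+\overline\nu]^{3HL}=0$. Cochains. $C^p_{\alpha+A,A}(\mathfrak g\oplus V,V)$ is the subspace of those elements of $C^p_{\gamma,\gamma}(W,W)$ taking values in $V$ (i.e. linear maps $\varphi:(\wedge^2W)^{\otimes p}\otimes W\to V$ which, if $p\ge1$, are skew-symmetric in the last three arguments, namely the two entries of the last bivector and the final vector, with $A\circ\varphi=\varphi\circ\gamma$ on all arguments). $\widetilde C^p_{\alpha+A,A}(\mathfrak g\oplus V,V)$ is the subspace of those $\varphi$ that vanish when all arguments lie in $V$, so that $C^p_{\alpha+A,A}(\mathfrak g\oplus V,V)=\widetilde C^p_{\alpha+A,A}(\mathfrak g\oplus V,V)\oplus C^p_A(V,V)$, where $C^p_A(V,V)$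 is the space of $(V,A)$-cochains $(\wedge^2V)^{\otimes p}\otimes V\to V$ defined in the same way. One has $[\pi+\overline\rho+\overline\nu,\widetilde C^p_{\alpha+A,A}(\mathfrak g\oplus V,V)]^{3HL}\subseteq\widetilde C^{p+1}_{\alpha+A,A}(\mathfrak g\oplus V,V)$. *)

(* Defs.v *)
From HB Require Import structures.
From mathcomp Require Import all_boot all_order all_algebra all_fingroup.
From mathcomp Require Import boolp classical_sets functions.

Set Implicit Arguments.
Unset Strict Implicit.
Unset Printing Implicit Defensive.

Import GRing.Theory.

Local Open Scope ring_scope.
Local Open Scope classical_set_scope.

Section Trilinear.
Variables (K : fieldType) (U1 U2 U3 U : lmodType K).

Record trilinear (f : U1 -> U2 -> U3 -> U) : Prop := Trilinear {
  trilinear1 : forall y z, linear (fun x => f x y z);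
  trilinear2 : forall x z, linear (fun y => f x y z);
  trilinear3 : forall x y, linear (fun z => f x y z) }.

End Trilinear.

Record three_hom_lie (K : fieldType) (g : lmodType K)
    (br : g -> g -> g -> g) (alpha : g -> g) : Prop := ThreeHomLie {
  thl_trilinear : trilinear br;
  thl_skew12 : forall x y z, br y x z = - br x y z;
  thl_skew23 : forall x y z, br x z y = - br x y z;
  thl_linear : linear alpha;
  thl_mult : forall x y z, alpha (br x y z) = br (alpha x) (alpha y) (alpha z);
  thl_identity : forall x y z u v,
    br (alpha u) (alpha v) (br x y z) =
      br (br u v x) (alpha y) (alpha z) + br (alpha x) (br u v y) (alpha z)
      + br (alpha x) (alpha y) (br u v z) }.

Section Cochains.
Variables (K : fieldType) (W : lmodType K).

(* Linear maps (Lambda^2 W)^{(x) p} (x) W -> W are represented by functions of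
   p pairs of vectors and one further vector; the pair (x, y) stands for the
   decomposable bivector x /\ y. The linearity and skew-symmetry that make such
   a function factor through the tensor product are part of [hom_cochain]. *)
Definition cochain (p : nat) : Type := {ffun 'I_p -> W * W} -> W -> W.

Definition subst_arg p (X : {ffun 'I_p -> W * W}) (i : 'I_p) (Y : W * W) :
  {ffun 'I_p -> W * W} := [ffun k => if k == i then Y else X k].

Definition bivmap (gamma : W -> W) (Y : W * W) : W * W :=
  (gamma Y.1, gamma Y.2).

Definition argmap (gamma : W -> W) p (X : {ffun 'I_p -> W * W}) :
  {ffun 'I_p -> W * W} := [ffun k => bivmap gamma (X k)].

(* The space C^p_{gamma,gamma}(W,W). The condition [hc_skew_last] concerns the
   last pair only, hence is void for p = 0. *)
Record hom_cochain (gamma : W -> W) (p : nat) (phi : cochain p) : Prop :=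
  HomCochain {
  hc_linear_fst : forall X i y x, linear (fun z => phi (subst_arg X i (z, y)) x);
  hc_linear_snd : forall X i y x, linear (fun z => phi (subst_arg X i (y, z)) x);
  hc_linear : forall X, linear (phi X);
  hc_skew : forall X i y z x,
    phi (subst_arg X i (z, y)) x = - phi (subst_arg X i (y, z)) x;
  hc_skew_last : forall X (i : 'I_p) y z x, i.+1 = p ->
    phi (subst_arg X i (y, x)) z = - phi (subst_arg X i (y, z)) x;
  hc_gamma : forall X x, gamma (phi X x) = phi (argmap gamma X) (gamma x) }.

Section Shuffles.
Variable n : nat.

(* For J = {j_1 < ... < j_p} with complement I = {i_1 < ... < i_q}, the word
   j_1 ... j_p i_1 ... i_q; [enum] lists a set of ordinals increasingly. *)
Definition shuffle_word (J : {set 'I_n}) : seq 'I_n :=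
  enum J ++ enum (~: J)%SET.

Lemma size_shuffle_word J : size (shuffle_word J) = n.
Proof. by rewrite size_cat -!cardE cardsC card_ord. Qed.

Lemma uniq_shuffle_word J : uniq (shuffle_word J).
Proof.
rewrite cat_uniq !enum_uniq /= andbT; apply/hasPn => i.
by rewrite !mem_enum inE.
Qed.

Lemma shuffle_word_inj J : injective (fun k : 'I_n => nth k (shuffle_word J) k).
Proof.
move=> k l /eqP; rewrite (set_nth_default l) ?size_shuffle_word //.
rewrite nth_uniq ?size_shuffle_word ?uniq_shuffle_word //.
by move=> /eqP /val_inj.
Qed.

Definition shuffle_perm (J : {set 'I_n}) : 'S_n := perm (@shuffle_word_inj J).

(* (X_{s_1}, ..., X_{s_m}) for S = {s_1 < ... < s_m}; only used with #|S| = m. *)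
Definition subargs m (X : {ffun 'I_n -> W * W}) (S : {set 'I_n}) :
  {ffun 'I_m -> W * W} := [ffun a : 'I_m => nth 0 [seq X i | i <- enum S] a].

(* The k-th smallest element of S, counting from 0. *)
Definition elt_of (S : {set 'I_n}) (k : nat) : nat :=
  nth 0%N [seq val i | i <- enum S] k.

End Shuffles.

(* phi o_gamma psi for phi of degree q and psi of degree p. The number n of
   bivector arguments is p + q in every use; it is a separate parameter so that
   no cast is needed between p + q and q + p. The bivector
   psi(X_J, ) . (x /\ y) is a sum of two decomposable ones, which phi,
   being linear, turns into a sum of two values. *)
Definition circ (gamma : W -> W) (q p n : nat)
    (phi : cochain q) (psi : cochain p) : cochain n :=
  fun X x =>
    (\sum_(J : {set 'I_n} | #|J| == p)
      \sum_(k < q | [forall j in J, (val j < elt_of (~: J)%SET k)%N])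
        let XJ := subargs p X J in
        let XI := subargs q X (~: J)%SET in
        let gXI := argmap (iter p gamma) XI in
        (-1) ^+ shuffle_perm J *:
        (phi (subst_arg gXI k (psi XJ (XI k).1, iter p gamma (XI k).2))
             (iter p gamma x)
         + phi (subst_arg gXI k (iter p gamma (XI k).1, psi XJ (XI k).2))
             (iter p gamma x)))
    + \sum_(J : {set 'I_n} | #|J| == p)
        (-1) ^+ shuffle_perm J *:
        phi (argmap (iter p gamma) (subargs q X (~: J)%SET))
            (psi (subargs p X J) x).

Definition bracket3HL (gamma : W -> W) (q p : nat)
    (phi : cochain q) (psi : cochain p) : cochain (q + p) :=
  fun X x => (-1) ^+ (p * q) *: circ gamma phi psi X x
             - circ gamma psi phi X x.

End Cochains.

Section GeneralizedRepresentation.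
Variables (K : fieldType) (g V : lmodType K).

Local Notation W := (g * V)%type.

Definition sum_map (alpha : g -> g) (A : V -> V) : W -> W :=
  fun w => (alpha w.1, A w.2).

(* pi + rho-bar + nu-bar on g (+) V, as a cochain of degree 1. *)
Definition total_bracket (br : g -> g -> g -> g) (rho : g -> g -> V -> V)
    (nu : g -> V -> V -> V) : cochain W 1 :=
  fun X c =>
    let a := (X ord0).1 in
    let b := (X ord0).2 in
    (br a.1 b.1 c.1,
     (rho a.1 b.1 c.2 + rho b.1 c.1 a.2 + rho c.1 a.1 b.2)
     + (nu a.1 b.2 c.2 + nu b.1 c.2 a.2 + nu c.1 a.2 b.2)).

Record generalized_rep (br : g -> g -> g -> g) (alpha : g -> g)
    (rho : g -> g -> V -> V) (nu : g -> V -> V -> V) (A : V -> V) : Prop :=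
  GeneralizedRep {
  gr_linear : linear A;
  gr_rho_trilinear : trilinear rho;
  gr_rho_skew : forall x y u, rho y x u = - rho x y u;
  gr_nu_trilinear : trilinear nu;
  gr_nu_skew : forall x u v, nu x v u = - nu x u v;
  gr_cochain : hom_cochain (sum_map alpha A) (total_bracket br rho nu);
  gr_bracket : forall X w,
    bracket3HL (sum_map alpha A) (total_bracket br rho nu)
      (total_bracket br rho nu) X w = 0 }.

(* C^p_{alpha+A,A}(g (+) V, V), inside C^p_{gamma,gamma}(g (+) V, g (+) V). *)
Definition V_cochain (alpha : g -> g) (A : V -> V) (p : nat) :
    set (cochain W p) :=
  [set phi : cochain W p | hom_cochain (sum_map alpha A) phi /\
     forall X w, (phi X w).1 = 0].

(* The subspace of those vanishing when all arguments lie in V. *)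
Definition tilde_cochain (alpha : g -> g) (A : V -> V) (p : nat) :
    set (cochain W p) :=
  [set phi : cochain W p | V_cochain alpha A phi /\
     forall (X : {ffun 'I_p -> W * W}) (w : W),
       (forall i, (X i).1.1 = 0 /\ (X i).2.1 = 0) -> w.1 = 0 ->
       phi X w = 0].

Definition hom_diff (br : g -> g -> g -> g) (alpha : g -> g)
    (rho : g -> g -> V -> V) (nu : g -> V -> V -> V) (A : V -> V) (p : nat)
    (phi : cochain W p) : cochain W p.+1 :=
  bracket3HL (sum_map alpha A) (total_bracket br rho nu) phi.

(* The complex is graded from degree 1: its p-cochains are the tilde_cochains
   with p.-1 bivector arguments. Degree 0 is not part of it. *)
Definition complex_space (alpha : g -> g) (A : V -> V) (p : nat) :
    set (cochain W p.-1) := @tilde_cochain alpha A p.-1.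

Definition complex_diff (br : g -> g -> g -> g) (alpha : g -> g)
    (rho : g -> g -> V -> V) (nu : g -> V -> V -> V) (A : V -> V) (p : nat) :
    cochain W p.-1 -> cochain W p.+1.-1 :=
  match p return cochain W p.-1 -> cochain W p.+1.-1 with
  | 0 => fun=> 0
  | k.+1 => @hom_diff br alpha rho nu A k
  end.

End GeneralizedRepresentation.

(* C p is a subspace of the ambient space T p, and the d p restrict to linear
   maps C p -> C p.+1 of square zero, in degrees p >= 1. *)
Record cochain_complex_from1 (K : fieldType) (T : nat -> lmodType K)
    (C : forall p, set (T p)) (d : forall p, T p -> T p.+1) : Prop :=
  CochainComplexFrom1 {
  cc_zero : forall p, (1 <= p)%N -> C p 0;
  cc_subspace : forall p, (1 <= p)%N ->
    forall (a : K) x y, C p x -> C p y -> C p (a *: x + y);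
  cc_maps : forall p, (1 <= p)%N -> forall x, C p x -> C p.+1 (d p x);
  cc_linear : forall p, (1 <= p)%N ->
    forall (a : K) x y, C p x -> C p y -> d p (a *: x + y) = a *: d p x + d p y;
  cc_square : forall p, (1 <= p)%N -> forall x, C p x -> d p.+1 (d p x) = 0 }.

(* Main.v *)
Require Import Defs.
From HB Require Import structures.
From mathcomp Require Import all_boot all_order all_algebra all_fingroup zify.
From mathcomp Require Import boolp classical_sets functions.

Set Implicit Arguments.
Unset Strict Implicit.
Unset Printing Implicit Defensive.

Import GRing.Theory.

Local Open Scope ring_scope.

(** Write P X x for the bracket of the bivector X and the vector x, and X . Y
for the bivector P X y1 /\ gamma y2 + gamma y1 /\ P X y2 when Y = y1 /\ y2.
The equation [P, P] = 0 unfolds, after division by 2, to the fundamental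
identity

  P (gamma X) (P Y x) = P (X . Y) (gamma x) + P (gamma Y) (P X x).

The square of the differential vanishes by the argument of Cartan calculus. Let
i_X be the contraction of a cochain with X in its first slot, and L_X the
operator
  L_X phi = P (gamma^p X) o phi - (phi with P X applied in one of the slots).
Sorting the terms of d phi according to whether X_1 is used by the bracket or
is passed on to phi gives
  i_X d = L_X - d i_X,
up to an extra term which is present only when phi has no bivector argument
left. So d can be defined by recursion on the list of bivectors, and if L_X
commutes with d, then
  i_X d d = L_X d - d i_X d = L_X d - d L_X + d d i_X = d d i_X,
whence d d = 0 by induction on the length of the list ([ldiff_square]). That
L_X commutes with d ([lie_ldiff]) follows by the same induction from
[L_X, L_Y] = L_(X . Y) ([lie_comm]), which is the fundamental identity read in
each slot; the extra term is handled by the fundamental identity again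
([lie_last], [ldiff_last]).

The twist by gamma obstructs this scheme in one place: for a cochain phi
commuting with gamma, the contraction i_X phi does not commute with gamma; it
satisfies gamma (phi (X, Y)) = phi (gamma X, gamma Y), which relates i_X phi to
i_(gamma X) phi. Everything is therefore stated for a pair phi, phi' with
gamma o phi = phi' o gamma ([intertwined]), where phi is used in the terms
P (_, phi), and phi' in the terms phi' (_, P, _); contraction replaces the
pair by i_X phi, i_(gamma X) phi'. The power of gamma in front of P is a
parameter m of its own, since contraction lowers the number of arguments of
phi and keeps this power.

The shuffle formula for the graded bracket is matched with the recursive
differential in [bracket3HL_degree1]: for a bracket of degree 1 only the
shuffles that move one letter to the front or to the end occur, with signs
(-1)^i and (-1)^(p+i). The remaining requirements on d phi are proved for the
recursive form: multilinearity, skew-symmetry in the last three vectors,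
compatibility with gamma, values in V, and vanishing on V. The last two hold
since V is an abelian ideal of the semidirect product. *)

(** * Identities in abelian groups *)

(** The proofs below end in rearrangements of signed sums of vectors. The tactic
[zmod_eq] settles them by comparing the integer coefficient of each atom. *)
Inductive zexpr : Type :=
| ZVar of nat
| ZZero
| ZAdd of zexpr & zexpr
| ZOpp of zexpr.

Fixpoint zeval (G : zmodType) (env : seq G) (e : zexpr) : G :=
  match e with
  | ZVar i => nth 0 env i
  | ZZero => 0
  | ZAdd e1 e2 => zeval env e1 + zeval env e2
  | ZOpp e1 => - zeval env e1
  end.

Fixpoint zcoef (e : zexpr) (i : nat) : int :=
  match e with
  | ZVar j => if j == i then 1 else 0
  | ZZero => 0
  | ZAdd e1 e2 => zcoef e1 i + zcoef e2 i
  | ZOpp e1 => - zcoef e1 i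
  end.

Lemma zeval_sum (G : zmodType) (env : seq G) e :
  zeval env e = \sum_(i < size env) env`_i *~ zcoef e i.
Proof.
elim: e => [j||e1 IH1 e2 IH2|e IH] /=.
- have [ltj|lej] := ltnP j (size env); last first.
    rewrite nth_default // big1 // => i _.
    by rewrite gtn_eqF ?mulr0z // (leq_trans (ltn_ord i)).
  rewrite (bigD1 (Ordinal ltj)) //= eqxx mulr1z big1 ?addr0 // => i.
  by rewrite -val_eqE /= eq_sym => /negbTE ->; rewrite mulr0z.
- by rewrite big1 // => i _; rewrite mulr0z.
- by rewrite IH1 IH2 -big_split; apply: eq_bigr => i _; rewrite mulrzDr.
- by rewrite IH -sumrN; apply: eq_bigr => i _; rewrite mulrNz.
Qed.

Lemma zeval_eq (G : zmodType) (env : seq G) e1 e2 :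
  all (fun i => zcoef e1 i == zcoef e2 i) (iota 0 (size env)) ->
  zeval env e1 = zeval env e2.
Proof.
move=> /allP eq12; rewrite !zeval_sum; apply: eq_bigr => i _.
by rewrite (eqP (eq12 i _)) // mem_iota ltn_ord.
Qed.

(* Atoms are compared up to conversion: the same vector may occur under
   different but convertible terms for a linear map or an iterate. *)
Ltac zindex env t :=
  lazymatch env with
  | cons ?u ?env' =>
      match constr:(Set) with
      | _ => let _ := match constr:(Set) with _ => unify t u end in constr:(O)
      | _ => let n := zindex env' t in constr:(S n)
      end
  end.

Ltac zadd env t :=
  match constr:(Set) with
  | _ => let _ := zindex env t in env
  | _ => constr:(cons t env)
  end.

Ltac zatoms env t :=
  lazymatch t with
  | GRing.add ?a ?b => let env := zatoms env a in zatoms env b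
  | GRing.opp ?a => zatoms env a
  | GRing.zero => env
  | _ => zadd env t
  end.

Ltac zreify env t :=
  lazymatch t with
  | GRing.add ?a ?b =>
      let a := zreify env a in let b := zreify env b in constr:(ZAdd a b)
  | GRing.opp ?a => let a := zreify env a in constr:(ZOpp a)
  | GRing.zero => constr:(ZZero)
  | _ => let n := zindex env t in constr:(ZVar n)
  end.

Ltac zmod_eq :=
  lazymatch goal with
  | |- @eq ?T ?l ?r =>
      let env := zatoms (@nil T) l in
      let env := zatoms env r in
      let el := zreify env l in
      let er := zreify env r in
      refine (@zeval_eq _ env el er _); exact: erefl
  end.

(** * Skew-symmetric bilinear functions of a pair *)

Lemma linear_zero (K : fieldType) (U U' : lmodType K) (h : U -> U') :
  linear h -> h 0 = 0.
Proof.
move=> hl; have /eqP := hl 1 0 0.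
by rewrite !scale1r addr0 -subr_eq0 opprD addNKr oppr_eq0 => /eqP.
Qed.

Lemma linear_opp (K : fieldType) (U U' : lmodType K) (h : U -> U') :
  linear h -> forall v, h (- v) = - h v.
Proof.
move=> hl v; have := hl (-1) v 0.
by rewrite (linear_zero hl) !addr0 !scaleN1r.
Qed.

(** Such a function is a linear map on the exterior square; linearity in the
second entry follows by skew-symmetry. *)
Record bivector_fun (K : fieldType) (W U : lmodType K) (f : W * W -> U) : Prop :=
  BivectorFun {
    biv_linear : forall y, linear (fun z => f (z, y));
    biv_skew : forall y z, f (z, y) = - f (y, z) }.

Section BivectorFunTheory.
Variables (K : fieldType) (W U U' : lmodType K).
Implicit Types f g : W * W -> U.

Lemma biv_linear2 f : bivector_fun f -> forall y, linear (fun z => f (y, z)).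
Proof.
move=> [fl fs] y a u v /=.
by rewrite fs fl opprD -scalerN -!fs.
Qed.

Lemma biv_addl f y z z' :
  bivector_fun f -> f (z + z', y) = f (z, y) + f (z', y).
Proof. by case=> fl _; have := fl y 1 z z'; rewrite !scale1r. Qed.

Lemma biv_addr f y z z' :
  bivector_fun f -> f (y, z + z') = f (y, z) + f (y, z').
Proof. by move=> /biv_linear2 fl; have := fl y 1 z z'; rewrite !scale1r. Qed.

Lemma biv_scalel f a y z : bivector_fun f -> f (a *: z, y) = a *: f (z, y).
Proof.
case=> fl _; have := fl y a z 0.
by rewrite (linear_zero (fl y)) !addr0.
Qed.

Lemma biv_scaler f a y z : bivector_fun f -> f (y, a *: z) = a *: f (y, z).
Proof.
by move=> hf; rewrite (biv_skew hf) biv_scalel // -scalerN -(biv_skew hf).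
Qed.

Lemma biv0 : bivector_fun (fun _ : W * W => 0 : U).
Proof. by split=> [y a u v|y z]; rewrite ?scaler0 ?addr0 ?oppr0. Qed.

Lemma bivD f g :
  bivector_fun f -> bivector_fun g -> bivector_fun (fun Y => f Y + g Y).
Proof.
move=> [fl fs] [gl gs]; split=> [y a u v|y z] /=.
  by rewrite fl gl scalerDr addrACA.
by rewrite fs gs opprD.
Qed.

Lemma bivN f : bivector_fun f -> bivector_fun (fun Y => - f Y).
Proof.
move=> [fl fs]; split=> [y a u v|y z] /=.
  by rewrite fl opprD scalerN.
by rewrite fs.
Qed.

Lemma biv_post f (h : U -> U') :
  linear h -> bivector_fun f -> bivector_fun (fun Y => h (f Y)).
Proof.
move=> hl [fl fs]; split=> [y a u v|y z] /=; first by rewrite fl hl.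
by rewrite fs (linear_opp hl).
Qed.

Lemma biv_pre f (h : W -> W) :
  linear h -> bivector_fun f -> bivector_fun (fun Y => f (bivmap h Y)).
Proof.
move=> hl [fl fs]; split=> [y a u v|y z]; rewrite /bivmap /=; last exact: fs.
by rewrite hl fl.
Qed.

(** This is the map induced on bivectors by the derivation that applies h to one
factor and g to the other. *)
Lemma biv_der f (g h : W -> W) : linear g -> linear h -> bivector_fun f ->
  bivector_fun (fun Y => f (h Y.1, g Y.2) + f (g Y.1, h Y.2)).
Proof.
move=> gl hl [fl fs]; split=> [y a u v|y z] /=.
  by rewrite hl gl !fl scalerDr addrACA.
by rewrite fs [X in _ + X]fs -opprD addrC.
Qed.

End BivectorFunTheory.

(** * The differential by recursion on the list of bivectors *)

(** Cochains are functions of a list of bivectors and a vector here, so that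
contraction with the first bivector is precomposition with a cons and no degree
has to be tracked. *)
Section Calculus.
Variables (K : fieldType) (W : lmodType K).
Variables (gm : {linear W -> W}) (P : W * W -> {linear W -> W}).

Local Notation bg := (bivmap gm).
Local Notation bgi m := (bivmap (iter m gm)).
Local Notation lcochain := (seq (W * W) -> W -> W).

Implicit Types (phi psi : lcochain) (X Y Z : W * W) (s : seq (W * W)) (x : W).

(** The value of f at the bivector X . Y, for f additive on bivectors: this avoids
naming a sum of two decomposable bivectors. *)
Definition act_on X (f : W * W -> W) Y : W :=
  f (P X Y.1, gm Y.2) + f (gm Y.1, P X Y.2).

(** The contraction of phi with Y in the first slot. *)
Definition ins Y phi : lcochain := fun s => phi (Y :: s).

(** The sum over all slots, the vector included, of phi with P X applied in that
slot and gamma in the others. *)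
Fixpoint subst_sum X phi s x : W :=
  if s is Y :: s' then
    act_on X (fun Z => phi (Z :: map bg s') (gm x)) Y
    + subst_sum X (ins (bg Y) phi) s' x
  else phi [::] (P X x).

(** The operator L_X on the pair phi, phi'. *)
Definition lie m X phi phi' : lcochain :=
  fun s x => P (bgi m X) (phi s x) - subst_sum X phi' s x.

(** The term in which the value of phi enters the bracket as a part of the last
bivector X; it arises only when no bivector is left after X. *)
Definition last_term m X phi : lcochain := fun s x =>
  if s is [::] then
    P (phi [::] X.1, iter m gm X.2) (iter m gm x)
    + P (iter m gm X.1, phi [::] X.2) (iter m gm x)
  else 0.

(** The Cartan formula for i_X d, with the extra term, taken as a definition. On the empty
list, which is no valid list of arguments of d phi, the value is 0. *)
Fixpoint ldiff m phi phi' s x : W :=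
  if s is X :: s' then
    lie m X phi phi' s' x + last_term m X phi s' x
    - ldiff m (ins X phi) (ins (bg X) phi') s' x
  else 0.

Lemma subst_sum_ext X phi psi : (forall s x, phi s x = psi s x) ->
  forall s x, subst_sum X phi s x = subst_sum X psi s x.
Proof.
move=> e s; elim: s phi psi e => [|Y s IH] phi psi e x /=; first exact: e.
by rewrite /act_on !e; congr (_ + _); apply: IH => *; apply: e.
Qed.

Lemma iter_linear m : linear (iter m gm).
Proof. by elim: m => [|m IH] a u v //=; rewrite IH linearP. Qed.

Lemma bgi_S m X : bgi m (bg X) = bgi m.+1 X.
Proof. by rewrite /bivmap /= -!iterSr. Qed.

Lemma bg_bgi m X : bg (bgi m X) = bgi m.+1 X.
Proof. by []. Qed.

Lemma subst_sumD X phi psi s x :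
  subst_sum X (fun s x => phi s x + psi s x) s x
  = subst_sum X phi s x + subst_sum X psi s x.
Proof.
elim: s phi psi => [|Y s IH] phi psi //=.
by rewrite /ins IH /act_on [RHS]addrACA; congr (_ + _); exact: addrACA.
Qed.

Lemma subst_sum_post X phi (h : {linear W -> W}) s x :
  subst_sum X (fun s x => h (phi s x)) s x = h (subst_sum X phi s x).
Proof.
elim: s phi => [|Y s IH] phi //=.
by rewrite /act_on !linearD /= -IH.
Qed.

Lemma subst_sum0 X s x : subst_sum X (fun _ _ => 0) s x = 0.
Proof. by elim: s => [|Y s IH] //=; rewrite /ins IH /act_on !addr0. Qed.

Lemma subst_sumN X phi s x :
  subst_sum X (fun s x => - phi s x) s x = - subst_sum X phi s x.
Proof.
elim: s phi => [|Y s IH] phi //=.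
by rewrite /ins IH /act_on !opprD.
Qed.

Lemma subst_sumZ X a phi s x :
  subst_sum X (fun s x => a *: phi s x) s x = a *: subst_sum X phi s x.
Proof.
elim: s phi => [|Y s IH] phi //=.
by rewrite /ins IH /act_on !scalerDr.
Qed.

Lemma lieP m X a phi phi' psi psi' s x :
  lie m X (fun s x => a *: phi s x + psi s x)
          (fun s x => a *: phi' s x + psi' s x) s x
  = a *: lie m X phi phi' s x + lie m X psi psi' s x.
Proof.
by rewrite /lie linearP subst_sumD subst_sumZ opprD addrACA scalerBr.
Qed.

Hypothesis biv_P : forall x, bivector_fun (fun Y => P Y x).

Lemma PDl y y' z x : P (y + y', z) x = P (y, z) x + P (y', z) x.
Proof. exact: (biv_addl _ _ _ (biv_P x)). Qed.

Lemma PDr y z z' x : P (y, z + z') x = P (y, z) x + P (y, z') x.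
Proof. exact: (biv_addr _ _ _ (biv_P x)). Qed.

Lemma PZl a y z x : P (a *: y, z) x = a *: P (y, z) x.
Proof. exact: biv_scalel (biv_P x). Qed.

Lemma PZr a y z x : P (y, a *: z) x = a *: P (y, z) x.
Proof. exact: biv_scaler (biv_P x). Qed.

Lemma PNl y z x : P (- y, z) x = - P (y, z) x.
Proof. by rewrite -scaleN1r PZl scaleN1r. Qed.

Lemma PNr y z x : P (y, - z) x = - P (y, z) x.
Proof. by rewrite -scaleN1r PZr scaleN1r. Qed.

Lemma P0l z x : P (0, z) x = 0.
Proof. by rewrite -[in LHS](scale0r (0 : W)) PZl scale0r. Qed.

Lemma P0r z x : P (z, 0) x = 0.
Proof. by rewrite -[in LHS](scale0r (0 : W)) PZr scale0r. Qed.

Lemma last_termP m X a phi psi s x :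
  last_term m X (fun s x => a *: phi s x + psi s x) s x
  = a *: last_term m X phi s x + last_term m X psi s x.
Proof.
case: s => [|Y s] /=; last by rewrite scaler0 addr0.
by rewrite PDl PDr PZl PZr addrACA scalerDr.
Qed.

Lemma ldiff_ext m phi phi' psi psi' :
  (forall s x, phi s x = psi s x) -> (forall s x, phi' s x = psi' s x) ->
  forall s x, ldiff m phi phi' s x = ldiff m psi psi' s x.
Proof.
move=> e e' s; elim: s phi phi' psi psi' e e' => [|Y s IH] phi phi' psi psi' e e' x //=.
rewrite (IH _ _ (ins Y psi) (ins (bg Y) psi')) //; try by move=> *; apply: e || apply: e'.
rewrite /lie e (subst_sum_ext _ e'); congr (_ + _ - _).
by case: s {IH} => //=; rewrite !e.
Qed.

Lemma ldiffP m a phi phi' psi psi' s x :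
  ldiff m (fun s x => a *: phi s x + psi s x)
          (fun s x => a *: phi' s x + psi' s x) s x
  = a *: ldiff m phi phi' s x + ldiff m psi psi' s x.
Proof.
elim: s phi phi' psi psi' => [|Y s IH] phi phi' psi psi' /=.
  by rewrite scaler0 addr0.
rewrite lieP last_termP (IH (ins Y phi) (ins (bg Y) phi') (ins Y psi) (ins (bg Y) psi')).
rewrite [in RHS]scalerBr [in RHS]scalerDr.
zmod_eq.
Qed.

Lemma ldiffD m phi phi' psi psi' s x :
  ldiff m (fun s x => phi s x + psi s x) (fun s x => phi' s x + psi' s x) s x
  = ldiff m phi phi' s x + ldiff m psi psi' s x.
Proof.
rewrite -[X in X + _]scale1r -ldiffP.
by apply: ldiff_ext => *; rewrite scale1r.
Qed.

Lemma ldiff0 m s x : ldiff m (fun _ _ => 0) (fun _ _ => 0) s x = 0.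
Proof.
have := ldiffD m (fun _ _ => 0) (fun _ _ => 0) (fun _ _ => 0) (fun _ _ => 0) s x.
rewrite (@ldiff_ext _ _ _ (fun _ _ => 0) (fun _ _ => 0)); try by move=> *; rewrite addr0.
by move/esym/eqP; rewrite -subr_eq0 addrK => /eqP.
Qed.

Lemma ldiffN m phi phi' s x :
  ldiff m (fun s x => - phi s x) (fun s x => - phi' s x) s x
  = - ldiff m phi phi' s x.
Proof.
apply/eqP; rewrite -subr_eq0 opprK -ldiffD; apply/eqP.
by rewrite -[RHS](ldiff0 m s x); apply: ldiff_ext => *; rewrite addNr.
Qed.

(** * The square of the differential *)

Hypothesis gmP : forall Y x, gm (P Y x) = P (bg Y) (gm x).

Lemma iter_gmP m Y x : iter m gm (P Y x) = P (bgi m Y) (iter m gm x).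
Proof. by elim: m => [|m IH] /=; [case: Y | rewrite IH gmP bg_bgi]. Qed.

(** Compatibility of P with gamma says that gamma (X . Y) = gamma X . gamma Y. *)
Lemma act_on_bg X (f : W * W -> W) Y :
  act_on (bg X) f (bg Y) = act_on X (fun Z => f (bg Z)) Y.
Proof. by rewrite /act_on /bivmap /= !gmP. Qed.

Lemma act_on_bgi m X (f : W * W -> W) Y :
  act_on (bgi m X) f (bgi m Y) = act_on X (fun Z => f (bgi m Z)) Y.
Proof. by rewrite /act_on /bivmap /= !iter_gmP -!iterS !iterSr. Qed.

Lemma subst_sum_bg X phi s x :
  subst_sum X (fun s x => phi (map bg s) (gm x)) s x
  = subst_sum (bg X) phi (map bg s) (gm x).
Proof.
elim: s phi => [|Y s IH] phi /=; first by rewrite gmP.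
by rewrite act_on_bg -IH.
Qed.

Lemma lie_bg m X phi phi' s x :
  lie m.+1 X (fun s x => phi (map bg s) (gm x)) (fun s x => phi' (map bg s) (gm x)) s x
  = lie m (bg X) phi phi' (map bg s) (gm x).
Proof. by rewrite /lie subst_sum_bg bgi_S. Qed.

Lemma last_term_bg m X phi s x :
  last_term m.+1 X (fun s x => phi (map bg s) (gm x)) s x
  = last_term m (bg X) phi (map bg s) (gm x).
Proof. by case: s => //=; rewrite -!iterS !iterSr. Qed.

(** The factors gamma supplied by the precomposition are the ones that P needs to
pass from gamma^m to gamma^(m+1). *)
Lemma ldiff_bg m phi phi' s x :
  ldiff m.+1 (fun s x => phi (map bg s) (gm x)) (fun s x => phi' (map bg s) (gm x)) s x
  = ldiff m phi phi' (map bg s) (gm x).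
Proof.
elim: s phi phi' => [|Y s IH] phi phi' //=.
by rewrite lie_bg last_term_bg -IH.
Qed.

Record multilinear phi : Prop := Multilinear {
  ml_biv : forall s1 s2 x, bivector_fun (fun Y => phi (s1 ++ Y :: s2) x);
  ml_linear : forall s, linear (phi s) }.

Lemma multilinear_ins Y phi : multilinear phi -> multilinear (ins Y phi).
Proof.
by case=> h1 h2; split=> [s1 s2 x|s]; [apply: (h1 (Y :: s1)) | apply: h2].
Qed.

Lemma mlD phi s x y : multilinear phi -> phi s (x + y) = phi s x + phi s y.
Proof. by case=> _ h; have := h s 1 x y; rewrite !scale1r. Qed.

Definition intertwined phi phi' :=
  forall s x, gm (phi s x) = phi' (map bg s) (gm x).

Lemma intertwined_ins Y phi phi' :
  intertwined phi phi' -> intertwined (ins Y phi) (ins (bg Y) phi').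
Proof. by move=> h s x; rewrite /ins h. Qed.

Hypothesis fundamental : forall X Y x,
  P (bg X) (P Y x) = act_on X (fun Z => P Z (gm x)) Y + P (bg Y) (P X x).

(** The fundamental identity on bivectors: X . (Y . Z) - Y . (X . Z) = (X . Y) . Z
up to twists. The terms with P X on one factor of Z and P Y on the other occur in
both iterated actions and cancel. *)
Lemma act_on_comm X Y (f : W * W -> W) Z : bivector_fun f ->
  act_on X (act_on (bg Y) f) Z + act_on X (fun Y' => act_on Y' f (bg Z)) Y
  = act_on Y (act_on (bg X) f) Z.
Proof.
move=> hf; rewrite /act_on /= !(fundamental X) /act_on /=.
rewrite !gmP !(biv_addl _ _ _ hf) !(biv_addr _ _ _ hf).
zmod_eq.
Qed.

Lemma subst_sum_act X phi Y Z s x :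
  subst_sum X (fun t y => act_on Y (fun Z' => phi (bg Z' :: map bg t) (gm y)) Z) s x
  = act_on Y (fun Z' => subst_sum (bg X) (ins (bg Z') phi) (map bg s) (gm x)) Z.
Proof. by rewrite /act_on subst_sumD -!subst_sum_bg. Qed.

(** The first bivector Z receives both substitutions, only the one by X, only the
one by Y, or none. *)
Lemma subst_sum2 X Y phi Z s x :
  subst_sum X (subst_sum (bg Y) phi) (Z :: s) x
  = act_on X (act_on (bg Y)
      (fun Z' => phi (Z' :: map bg (map bg s)) (gm (gm x)))) Z
    + act_on X (fun Z' =>
        subst_sum (bg Y) (ins (bg Z') phi) (map bg s) (gm x)) Z
    + act_on Y (fun Z' =>
        subst_sum (bg X) (ins (bg Z') phi) (map bg s) (gm x)) Z
    + subst_sum X (subst_sum (bg Y) (ins (bg (bg Z)) phi)) s x.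
Proof.
rewrite -(subst_sum_act X phi Y) -addrA -subst_sumD [LHS]/=; congr (_ + _).
  by rewrite /act_on /=; zmod_eq.
by apply: subst_sum_ext => t y; rewrite [LHS]/ins /= act_on_bg.
Qed.

(** Substitutions by X and Y in different slots commute, and in the same slot the
fundamental identity gives a substitution by X . Y. *)
Lemma subst_sum_comm X Y phi s x : multilinear phi ->
  subst_sum X (subst_sum (bg Y) phi) s x
  + act_on X (fun Z => subst_sum Z phi (map bg s) (gm x)) Y
  = subst_sum Y (subst_sum (bg X) phi) s x.
Proof.
elim: s phi => [|Z s IH] phi hphi.
  by rewrite /= (fundamental X) /act_on /= !mlD //; zmod_eq.
rewrite !subst_sum2 -(IH (ins (bg (bg Z)) phi)); last by do !apply: multilinear_ins.
have hf : bivector_fun (fun Z' => phi (Z' :: map bg (map bg s)) (gm (gm x))).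
  exact: (ml_biv hphi [::]).
rewrite -(act_on_comm X Y Z hf) {2}/act_on /= /act_on /=; zmod_eq.
Qed.

(** [L_X, L_Y] = L_(X . Y) up to twists. The mixed terms, with P X outside phi and
P Y inside or conversely, are symmetric in X and Y; the outer and the inner terms
are the fundamental identity and [subst_sum_comm]. *)
Lemma lie_comm m X Y phi phi' phi'' s x :
  intertwined phi phi' -> multilinear phi'' ->
  lie m.+1 X (lie m Y phi phi') (lie m (bg Y) phi' phi'') s x
  = act_on X (fun Z => lie m Z phi' phi'' (map bg s) (gm x)) Y
    + lie m.+1 Y (lie m X phi phi') (lie m (bg X) phi' phi'') s x.
Proof.
move=> e hphi.
have lieE U V : lie m.+1 U (lie m V phi phi') (lie m (bg V) phi' phi'') s x
  = P (bgi m.+1 U) (P (bgi m V) (phi s x))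
    - P (bgi m.+1 U) (subst_sum V phi' s x)
    - P (bgi m.+1 V) (subst_sum U phi' s x)
    + subst_sum U (subst_sum (bg V) phi'') s x.
  rewrite {1}/lie linearB /= subst_sumD subst_sumN subst_sum_post bgi_S.
  zmod_eq.
rewrite !lieE -(subst_sum_comm X Y) // -!bg_bgi.
rewrite (fundamental (bgi m X)) act_on_bgi e /lie /act_on; zmod_eq.
Qed.

(** Write c(Y) for the bivector phi y1 /\ gamma^m y2 + gamma^m y1 /\ phi y2, and c'
for the same with phi'. Replacing phi by L_X phi in c(Y) gives
gamma^m X . c(Y) - c'(X . Y): the mixed terms gamma (phi y1) /\ gamma^m (P X y2) and
phi' (gamma y1) /\ gamma^m (P X y2) agree because phi and phi' are intertwined. The
rest is the fundamental identity for gamma^m X and c(Y). *)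
Lemma lie_last m X Y phi phi' s x : intertwined phi phi' ->
  lie m.+1 X (last_term m Y phi) (last_term m (bg Y) phi') s x
  = act_on X (fun Z => last_term m Z phi' (map bg s) (gm x)) Y
    + last_term m.+1 Y (lie m X phi phi') s x.
Proof.
move=> e; case: s => [|Z s]; last first.
  by rewrite /lie /= subst_sum0 /act_on !linear0; zmod_eq.
rewrite /lie /=.
have e0 y : phi' [::] (gm y) = gm (phi [::] y) by rewrite e.
rewrite -bg_bgi linearD !(fundamental (bgi m X)) /act_on /=.
rewrite !PDl !PDr !PNl !PNr !e0 !iter_gmP -!iterSr /=.
zmod_eq.
Qed.

(** L_X commutes with d. After the Cartan formula in Y at a list Y :: s, induction
applies to i_Y phi, and [lie_comm] and [lie_last] leave terms in X . Y. These are
cancelled by the substitution of P X into the slot Y of d phi, again by the Cartan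
formula, now in X . Y. *)
Lemma lie_ldiff m X phi phi' phi'' s x :
  intertwined phi phi' -> intertwined phi' phi'' -> multilinear phi'' ->
  lie m.+1 X (ldiff m phi phi') (ldiff m phi' phi'') s x
  = ldiff m.+1 (lie m X phi phi') (lie m (bg X) phi' phi'') s x.
Proof.
elim: s phi phi' phi'' x => [|Y s IH] phi phi' phi'' x e e' hphi.
  by rewrite /lie /= linear0 subr0.
(* Contracting L_U ps with V leaves out the substitution into V itself. *)
have insL U V ps ps' : forall t y, ins V (lie m U ps ps') t y
  = lie m U (ins V ps) (ins (bg V) ps') t y
    - act_on U (fun Z => ins Z ps' (map bg t) (gm y)) V.
  by move=> t y; rewrite /ins /lie /= /ins; zmod_eq.
have insD U ps ps' : forall t y, ins U (ldiff m ps ps') t y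
  = (lie m U ps ps' t y + last_term m U ps t y)
    - ldiff m (ins U ps) (ins (bg U) ps') t y by [].
have -> : lie m.+1 X (ldiff m phi phi') (ldiff m phi' phi'') (Y :: s) x
  = lie m.+1 X (lie m Y phi phi') (lie m (bg Y) phi' phi'') s x
    + lie m.+1 X (last_term m Y phi) (last_term m (bg Y) phi') s x
    - lie m.+1 X (ldiff m (ins Y phi) (ins (bg Y) phi'))
        (ldiff m (ins (bg Y) phi') (ins (bg (bg Y)) phi'')) s x
    - act_on X (fun Z => ldiff m phi' phi'' (Z :: map bg s) (gm x)) Y.
  rewrite /lie /= !linearD /= !linearN /=.
  rewrite (subst_sum_ext X (insD _ _ _)) !subst_sumD !subst_sumN /act_on; zmod_eq.
rewrite IH; try exact: intertwined_ins; last exact: multilinear_ins.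
rewrite (lie_comm m X) // (lie_last m X) //= /act_on /=.
rewrite (ldiff_ext m.+1 (insL _ _ _ _) (insL _ _ _ _)) ldiffD ldiffN.
rewrite [X in _ = _ - (_ - X)](_ : _ = act_on X (fun Z =>
  ldiff m (ins Z phi') (ins (bg Z) phi'') (map bg s) (gm x)) Y).
  by rewrite /act_on; zmod_eq.
rewrite /act_on -!ldiff_bg -ldiffD; apply: ldiff_ext => // t y.
by rewrite /bivmap /= !gmP.
Qed.

(** For a list of one bivector Y this is the fundamental identity for the bivector
phi x1 /\ gamma^m x2 + gamma^m x1 /\ phi x2 and gamma^m Y; on longer lists every
term is zero, because [last_term m X phi] is zero on nonempty lists. *)
Lemma ldiff_last m X phi phi' s x : intertwined phi phi' ->
  ldiff m.+1 (last_term m X phi) (last_term m (bg X) phi') s x = 0.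
Proof.
move=> e; case: s => [//|Y [/=|Z s]].
  have e0 y : phi' [::] (gm y) = gm (phi [::] y) by rewrite e.
  rewrite /lie /= -bg_bgi subr0 linearD /=.
  rewrite -!iterSr /= !e0.
  have fundamental' c1 c2 z : P (gm c1, gm c2) (P (bgi m Y) z) = _
    := fundamental (c1, c2) (bgi m Y) z.
  rewrite iter_gmP !fundamental' /act_on /= !PDl !PDr; zmod_eq.
have -> : ldiff m.+1 (last_term m X phi) (last_term m (bg X) phi') (Y :: Z :: s) x
  = P (bgi m.+1 Y) 0
    - (0 + 0 + subst_sum Y (fun _ _ => 0) s x) + 0
    - ldiff m.+1 (fun _ _ => 0) (fun _ _ => 0) (Z :: s) x by [].
by rewrite linear0 subst_sum0 ldiff0; zmod_eq.
Qed.

(** The Cartan formula, used twice, reduces this to the shorter list, since L_X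
commutes with d and d kills the extra term. *)
Lemma ldiff_square m phi phi' phi'' s x :
  intertwined phi phi' -> intertwined phi' phi'' -> multilinear phi'' ->
  ldiff m.+1 (ldiff m phi phi') (ldiff m phi' phi'') s x = 0.
Proof.
elim: s phi phi' phi'' => [|X s IH] phi phi' phi'' e e' hphi //.
have insD U ps ps' : forall t y, ins U (ldiff m ps ps') t y
  = (lie m U ps ps' t y + last_term m U ps t y)
    - ldiff m (ins U ps) (ins (bg U) ps') t y by [].
rewrite [LHS]/=.
rewrite (ldiff_ext m.+1 (insD _ _ _) (insD _ _ _)) ldiffD ldiffN ldiffD.
rewrite lie_ldiff // ldiff_last // IH; try exact: intertwined_ins; last exact: multilinear_ins.
have -> : last_term m.+1 X (ldiff m phi phi') s x = 0.
  by case: s {IH} => //=; rewrite P0l P0r addr0.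
zmod_eq.
Qed.

(** * Symmetry and equivariance of the differential *)

Lemma subst_sum_biv X (F : W * W -> lcochain) s x :
  (forall t y, bivector_fun (fun Y => F Y t y)) ->
  bivector_fun (fun Y => subst_sum X (F Y) s x).
Proof.
elim: s F => [|U s IH] F hF /=; first exact: hF.
apply: bivD; first by apply: bivD; apply: hF.
by apply: IH => t y; apply: hF.
Qed.

Lemma subst_sum_biv_op phi s x : multilinear phi ->
  bivector_fun (fun Y => subst_sum Y phi s x).
Proof.
elim: s phi => [|U s IH] phi hphi /=.
  by apply: (biv_post (h := phi [::])) => //; exact: ml_linear.
apply: bivD; last exact/IH/multilinear_ins.
have hU c : bivector_fun (fun Y => phi (Y :: map bg s) c) := ml_biv hphi [::] _ _.
apply: bivD.
  apply: (biv_post (h := fun w => phi ((w, gm U.2) :: map bg s) (gm x))) => //.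
  exact: (biv_linear (hU _)).
apply: (biv_post (h := fun w => phi ((gm U.1, w) :: map bg s) (gm x))) => //.
exact: (biv_linear2 (hU _)).
Qed.

Lemma multilinear_subst_sum X phi :
  multilinear phi -> multilinear (subst_sum X phi).
Proof.
move=> hphi; split=> [s1|].
  elim: s1 phi hphi => [|U s1 IH] phi hphi s2 x /=.
    apply: bivD.
      apply: (@biv_der _ _ _ (fun Z => phi (Z :: map bg s2) (gm x))).
      - exact: linearP.
      - exact: linearP.
      - exact: (ml_biv hphi [::]).
    apply: subst_sum_biv => t y.
    apply: (biv_pre (f := fun Z => phi (Z :: t) y)); first exact: linearP.
    exact: (ml_biv hphi [::]).
  apply: bivD; last exact/IH/multilinear_ins.
  have h Z : bivector_fun (fun Y => phi (Z :: map bg (s1 ++ Y :: s2)) (gm x)).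
    have := biv_pre (@linearP _ _ _ _ gm) (ml_biv hphi (Z :: map bg s1) (map bg s2) (gm x)).
    by congr bivector_fun; apply: funext => Y; rewrite map_cat.
  by apply: bivD; apply: h.
move=> s; elim: s phi hphi => [|U s IH] phi hphi a u v /=.
  by rewrite linearP (ml_linear hphi).
rewrite (IH (ins _ _)) /act_on; last exact: multilinear_ins.
by rewrite linearP !(ml_linear hphi) !scalerDr; zmod_eq.
Qed.

Lemma last_term_biv m s x phi : multilinear phi ->
  bivector_fun (fun Y => last_term m Y phi s x).
Proof.
case: s => [|U s] hphi /=; last exact: biv0.
apply: (biv_der (f := fun Z => P Z (iter m gm x))) => //.
  exact: iter_linear.
exact: ml_linear.
Qed.

Lemma ldiff_biv m (F F' : W * W -> lcochain) s x :
  (forall t y, bivector_fun (fun Y => F Y t y)) ->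
  (forall t y, bivector_fun (fun Y => F' Y t y)) ->
  bivector_fun (fun Y => ldiff m (F Y) (F' Y) s x).
Proof.
elim: s F F' => [|U s IH] F F' hF hF' /=; first exact: biv0.
apply: bivD; last by apply: bivN; apply: IH => t y; [apply: hF | apply: hF'].
apply: bivD.
  apply: bivD; last by apply: bivN; apply: subst_sum_biv.
  by apply: (biv_post (h := P _)) => //; exact: linearP.
case: s {IH} => [|V s] /=; last exact: biv0.
apply: bivD.
  apply: (biv_post (h := fun w => P (w, _) _)) => //.
  exact: (biv_linear (biv_P _)).
apply: (biv_post (h := fun w => P (_, w) _)) => //.
exact: (biv_linear2 (biv_P _)).
Qed.

Lemma multilinear_ldiff m phi phi' :
  multilinear phi -> multilinear phi' -> multilinear (ldiff m phi phi').
Proof.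
move=> hphi hphi'; split=> [s1|].
  elim: s1 phi phi' hphi hphi' => [|U s1 IH] phi phi' hphi hphi' s2 x /=.
    apply: bivD.
      apply: bivD; last exact: last_term_biv.
      apply: bivD; last by apply: bivN; apply: subst_sum_biv_op.
      apply: (biv_pre (f := fun Y => P Y _)) => //; exact: iter_linear.
    apply/bivN/ldiff_biv => t y; first exact: (ml_biv hphi [::]).
    apply: (biv_pre (f := fun Y => phi' (Y :: t) y)); first exact: linearP.
    exact: (ml_biv hphi' [::]).
  apply: bivD; last by apply/bivN/IH; apply: multilinear_ins.
  apply: bivD; last by case: (s1); [exact: biv0 | move=> *; exact: biv0].
  apply: bivD; last exact/bivN/(ml_biv (multilinear_subst_sum _ _)).
  apply: (biv_post (h := P _)); first exact: linearP.
  exact: ml_biv.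
move=> s; elim: s phi phi' hphi hphi' => [|U s IH] phi phi' hphi hphi' a u v /=.
  by rewrite scaler0 addr0.
rewrite (IH (ins _ _)); try exact: multilinear_ins.
rewrite /lie (ml_linear hphi) (ml_linear (multilinear_subst_sum _ hphi')).
case: s {IH} => [|V s]; rewrite /= ?iter_linear !linearP /= !scalerDr !scalerN.
  by zmod_eq.
by rewrite scaler0; zmod_eq.
Qed.

Lemma intertwined_subst_sum X phi phi' s x : intertwined phi phi' ->
  gm (subst_sum X phi s x) = subst_sum (bg X) phi' (map bg s) (gm x).
Proof.
move=> e; rewrite -subst_sum_bg -subst_sum_post.
by apply: subst_sum_ext => t y; rewrite e.
Qed.

Lemma intertwined_ldiff m phi phi' phi'' :
  intertwined phi phi' -> intertwined phi' phi'' ->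
  intertwined (ldiff m phi phi') (ldiff m phi' phi'').
Proof.
move=> e e' s; elim: s phi phi' phi'' e e' => [|U s IH] phi phi' phi'' e e' x /=.
  exact: linear0.
rewrite linearB linearD /=.
rewrite (IH (ins U phi) (ins (bg U) phi') (ins (bg (bg U)) phi''));
  try exact: intertwined_ins.
congr (_ + _ - _).
  rewrite /lie linearB /= (intertwined_subst_sum _ _ _ e') gmP e bgi_S //.
case: s {IH} => [|V s] /=; last exact: linear0.
by rewrite linearD /= !gmP /bivmap /= !e -!iterS !iterSr.
Qed.

Hypothesis skew_P : forall y z x, P (y, z) x = - P (y, x) z.

Definition skew_last phi :=
  forall s y z x, phi (rcons s (y, z)) x = - phi (rcons s (y, x)) z.

Lemma skew_last_ins Y phi : skew_last phi -> skew_last (ins Y phi).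
Proof. by move=> h s; apply: (h (Y :: s)). Qed.

(** Only the case of a single bivector (y, z) mixes y, z and x: there the
substitutions into y, z and x are permuted among themselves up to sign. *)
Lemma skew_last_subst_sum X phi : skew_last phi -> skew_last (subst_sum X phi).
Proof.
move=> h s; elim: s phi h => [|U s IH] phi h y z x /=.
  rewrite /act_on /ins /bivmap /=.
  rewrite (h [::] (P X y)) (h [::] (gm y) (P X z)) (h [::] (gm y) (gm z)) /=.
  zmod_eq.
rewrite (IH (ins _ _)); last exact: skew_last_ins.
by rewrite /act_on !map_rcons -!rcons_cons !(h _ _ _ (gm x)); zmod_eq.
Qed.

(** On a single bivector (y, z), the extra term of the differential completes
P (gamma^m y, gamma^m z) (phi x) to a sum over the three places of phi, which is
skew because P is. *)
Lemma skew_last_ldiff m phi phi' : multilinear phi' ->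
  skew_last phi -> skew_last phi' -> skew_last (ldiff m phi phi').
Proof.
move=> hphi' h h' s.
elim: s phi phi' hphi' h h' => [|U s IH] phi phi' hphi' h h' y z x /=.
  have phi'N v : phi' [::] (- v) = - phi' [::] v.
    exact: linear_opp (ml_linear hphi' [::]) v.
  rewrite /lie /= (skew_P y z x) phi'N /bivmap /=.
  rewrite (skew_P (phi [::] y)) (skew_P _ (phi [::] z)) (skew_P _ _ (phi [::] x)).
  zmod_eq.
rewrite (IH (ins _ _)); [|exact: multilinear_ins|exact: skew_last_ins..].
rewrite /lie h linearN /= (skew_last_subst_sum _ h').
by case: s {IH} => [|V s] /=; zmod_eq.
Qed.

Definition supported p phi := forall s x, size s != p -> phi s x = 0.

Lemma supported_ldiff m p phi phi' : supported p phi -> supported p phi' ->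
  supported p.+1 (ldiff m phi phi').
Proof.
have suppT X ps q : supported q ps -> supported q (subst_sum X ps).
  move=> h t y; elim: t ps q h => [|V t IH] ps q h /=; first by move=> *; apply: h.
  move=> hs; rewrite /act_on !h /= ?size_map // !add0r.
  case: q h hs => [|q] h hs; last by apply: (IH _ q) => // u v hu; apply: h.
  by rewrite -[RHS](subst_sum0 X t y); apply: subst_sum_ext => u v; apply: h.
move=> h h' s; elim: s p phi phi' h h' => [|X s IH] p phi phi' h h' x //=.
rewrite eqSS => hs; rewrite /lie h // (suppT _ _ _ h') // linear0 subr0 add0r.
have -> : last_term m X phi s x = 0.
  by case: s hs {IH} => //= hs; rewrite !h // P0l P0r addr0.
case: p h h' hs => [|p] h h' hs.
  rewrite sub0r (@ldiff_ext _ _ _ (fun _ _ => 0) (fun _ _ => 0)) ?ldiff0 ?oppr0 //.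
    by move=> t y; apply: h.
  by move=> t y; apply: h'.
rewrite sub0r (IH p) ?oppr0 // => t y ht; [exact: h | exact: h'].
Qed.

(** Each term of d phi is a value of phi, or a bracket with a value of phi as one of
its entries. *)
Section Ideal.
Variable N : W -> Prop.
Hypothesis N0 : N 0.
Hypotheses (ND : forall u v, N u -> N v -> N (u + v)).
Hypotheses (NN : forall u, N u -> N (- u)).
Hypotheses (NP : forall Y x, N x -> N (P Y x)).
Hypotheses (NPl : forall y z x, N y -> N (P (y, z) x)).
Hypotheses (NPr : forall y z x, N z -> N (P (y, z) x)).

Lemma ldiff_ideal m phi phi' :
  (forall s x, N (phi s x)) -> (forall s x, N (phi' s x)) ->
  forall s x, N (ldiff m phi phi' s x).
Proof.
have subN X ps : (forall s x, N (ps s x)) -> forall s x, N (subst_sum X ps s x).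
  move=> h s; elim: s ps h => [|U s IH] ps h x /=; first exact: h.
  by apply: ND; [apply: ND; apply: h | apply: IH => *; apply: h].
move=> h h' s; elim: s phi phi' h h' => [|U s IH] phi phi' h h' x //=.
apply: ND; last by apply: NN; apply: IH => *; [apply: h | apply: h'].
apply: ND; first by apply: ND; [exact/NP/h | exact/NN/subN/h'].
by case: s {IH} => [|V s] //=; apply: ND; [apply: NPl | apply: NPr].
Qed.

End Ideal.

(** If the bracket vanishes on a gamma-stable subset S, then every term of d phi
with all arguments in S contains a bracket of elements of S or a value of phi on
S; so vanishing on S is inherited by d phi. *)
Section Vanishing.
Variable S : W -> Prop.
Hypothesis S0 : S 0.
Hypotheses (Sgm : forall u, S u -> S (gm u)).
Hypothesis (SP : forall y z x, S y -> S z -> S x -> P (y, z) x = 0).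

Definition entries_in s := forall Y, Y \in s -> S Y.1 /\ S Y.2.

Definition vanishes_on phi := forall s x, entries_in s -> S x -> phi s x = 0.

Lemma entries_in_cons Y s : entries_in (Y :: s) <-> (S Y.1 /\ S Y.2) /\ entries_in s.
Proof.
split=> [h|[hY h] Z].
  by split; [apply: h; rewrite mem_head | move=> Z Zs; apply: h; rewrite inE Zs orbT].
by rewrite inE => /orP[/eqP ->|/h].
Qed.

Lemma entries_in_map s : entries_in s -> entries_in (map bg s).
Proof. by move=> h _ /mapP[Y /h[? ?] ->]; split; apply: Sgm. Qed.

Lemma vanishes_ins Y phi : S Y.1 -> S Y.2 -> vanishes_on phi -> vanishes_on (ins Y phi).
Proof. by move=> h1 h2 h s x hs; apply: h; apply/entries_in_cons. Qed.

Lemma vanishes_ldiff m phi phi' :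
  vanishes_on phi -> vanishes_on phi' -> vanishes_on (ldiff m phi phi').
Proof.
have subV X ps : S X.1 -> S X.2 -> vanishes_on ps -> vanishes_on (subst_sum X ps).
  case: X => X1 X2 /= hX1 hX2 h s; elim: s ps h => [|U s IH] ps h x.
    by move=> hs hx /=; rewrite SP // h.
  move=> /entries_in_cons[[hU1 hU2] hs] hx /=.
  rewrite /act_on !SP // IH //; last by apply: vanishes_ins => //; apply: Sgm.
  have hs' := entries_in_map hs.
  by rewrite !h ?addr0 //; try exact: Sgm; apply/entries_in_cons; do !split => //=; apply: Sgm.
move=> h h' s; elim: s phi phi' h h' => [|U s IH] phi phi' h h' x //.
move=> /entries_in_cons[[hU1 hU2] hs] hx /=.
rewrite (IH (ins U phi)) //; try by apply: vanishes_ins => //; apply: Sgm.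
rewrite /lie h // subV // linear0.
case: s hs {IH} => [|V s] hs /=; last by zmod_eq.
by rewrite !h // P0l P0r; zmod_eq.
Qed.

End Vanishing.

End Calculus.

(** * Shuffles with one letter on one side *)

Section ExtremeShuffles.

Lemma sum_card1 (W : nmodType) n (F : {set 'I_n} -> W) :
  \sum_(J : {set 'I_n} | #|J| == 1%N) F J = \sum_i F [set i]%SET.
Proof.
rewrite -(big_imset _ (h := fun i => [set i]%SET)) /=; last by move=> i j _ _ /finset.set1_inj.
apply: eq_bigl => J; apply/cards1P/imsetP => [[i ->]|[i _ ->]]; last by exists i.
by exists i.
Qed.

Lemma sum_cardC1 (W : nmodType) p (F : {set 'I_p.+1} -> W) :
  \sum_(J : {set 'I_p.+1} | #|J| == p) F J = \sum_i F (~: [set i])%SET.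
Proof.
rewrite (reindex_inj (@finset.setC_inj _)) /= -(sum_card1 (fun J => F (~: J)%SET)); apply: eq_bigl => J.
have := cardsC J; rewrite card_ord; move: #|J| #|~: J|%SET => a b ab.
lia.
Qed.

Lemma enum_setC1 p (i : 'I_p.+1) :
  enum (~: [set i])%SET = [seq lift i a | a <- enum 'I_p].
Proof.
apply: (inj_map val_inj); apply: (@irr_sorted_eq _ ltn).
- exact: ltn_trans.
- exact: ltnn.
- have sub : subseq [seq val j | j <- enum (~: [set i])%SET]
                    [seq val j | j <- enum 'I_p.+1].
    by apply: map_subseq; rewrite [X in subseq _ X]enumT; exact: filter_subseq.
  by apply: (subseq_sorted _ sub); [exact: ltn_trans | rewrite val_enum_ord iota_ltn_sorted].
- rewrite -map_comp sorted_map.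
  have : sorted ltn (map val (enum 'I_p)) by rewrite val_enum_ord iota_ltn_sorted.
  rewrite sorted_map; apply: sub_sorted => a b /=.
  by rewrite /bump; do 2!case: leqP; lia.
move=> k; apply/mapP/mapP => [[j]|[j]].
  rewrite mem_enum !inE eq_sym => /unlift_some[a -> _] ->.
  by exists (lift i a) => //; rewrite map_f ?mem_enum.
by case/mapP=> a _ -> ->; exists (lift i a) => //; rewrite mem_enum !inE eq_sym neq_lift.
Qed.

Lemma nth_enum_setC1 p (i : 'I_p.+1) k (a : 'I_p) : a = k :> nat -> forall d,
  nth d (enum (~: [set i])%SET) k = lift i a.
Proof.
by move=> <- d; rewrite enum_setC1 (nth_map a) ?size_enum_ord // nth_ord_enum.
Qed.

(** Moving the letter i to the front takes i transpositions. *)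
Lemma sign_shuffle_set1 (K : fieldType) p (i : 'I_p.+1) :
  (-1) ^+ shuffle_perm [set i]%SET = (-1) ^+ i :> K.
Proof.
have -> : shuffle_perm [set i]%SET = lift_perm ord0 i 1.
  apply/permP => k; rewrite permE /shuffle_word finset.enum_set1 /=.
  have [a ->|->] := unliftP ord0 k; last by rewrite lift_perm_id.
  by rewrite lift_perm_lift perm1 lift0 /= (nth_enum_setC1 _ (a := a)).
by rewrite odd_lift_perm odd_perm1 addbF /= signr_odd.
Qed.

(** Moving the letter i to the end of a word of p + 1 letters takes p - i
transpositions. *)
Lemma sign_shuffle_setC1 (K : fieldType) p (i : 'I_p.+1) :
  (-1) ^+ shuffle_perm (~: [set i])%SET = (-1) ^+ p * (-1) ^+ i :> K.
Proof.
have -> : shuffle_perm (~: [set i])%SET = lift_perm ord_max i 1.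
  apply/permP => k; rewrite permE /shuffle_word finset.setCK finset.enum_set1 /=.
  rewrite nth_cat enum_setC1 size_map size_enum_ord.
  have [a ->|->] := unliftP ord_max k.
    by rewrite lift_perm_lift perm1 lift_max ltn_ord -enum_setC1 (nth_enum_setC1 _ (a := a)).
  by rewrite lift_perm_id ltnn subnn.
by rewrite odd_lift_perm odd_perm1 addbF /= signr_addb !signr_odd.
Qed.

Lemma subargs_set1 (K : fieldType) (W : lmodType K) n (X : {ffun 'I_n -> W * W}) i :
  subargs 1 X [set i]%SET = [ffun=> X i].
Proof. by apply/ffunP => a; rewrite !ffunE finset.enum_set1 ord1. Qed.

Lemma subargs_setC1 (K : fieldType) (W : lmodType K) p (X : {ffun 'I_p.+1 -> W * W}) i :
  subargs p X (~: [set i])%SET = [ffun a => X (lift i a)].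
Proof.
apply/ffunP => a; rewrite !ffunE (nth_map i) ?(nth_enum_setC1 _ (a := a)) //.
by rewrite enum_setC1 size_map size_enum_ord.
Qed.

Lemma elt_of_setC1 p (i : 'I_p.+1) (a : 'I_p) : elt_of (~: [set i])%SET a = lift i a.
Proof.
rewrite /elt_of (nth_map i) ?(nth_enum_setC1 _ (a := a)) //.
by rewrite enum_setC1 size_map size_enum_ord.
Qed.

Lemma elt_of_set1 n (i : 'I_n) : elt_of [set i]%SET 0 = i.
Proof. by rewrite /elt_of finset.enum_set1. Qed.

Lemma all_setC1_lt p (i : 'I_p.+1) :
  [forall j in (~: [set i])%SET, (val j < i)%N] = (i == ord_max).
Proof.
apply/forall_inP/eqP => [h|-> j]; last first.
  by rewrite !inE -val_eqE /= => jp; rewrite ltn_neqAle jp -ltnS ltn_ord.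
apply/val_inj/eqP; rewrite eqn_leq -ltnS ltn_ord /= leqNgt; apply/negP => ip.
have := h ord_max; rewrite !inE -val_eqE /= neq_ltn ip orbT => /(_ isT).
by rewrite ltnNge ltnW.
Qed.

Lemma all_set1_lt n (i : 'I_n) k :
  [forall j in [set i]%SET, (val j < k)%N] = (i < k)%N.
Proof.
apply/forall_inP/idP => [h|h j]; first by apply: h; rewrite finset.set11.
by move=> /finset.set1P ->.
Qed.

End ExtremeShuffles.

(** * The graded bracket with a cochain of degree one *)

Section Translation.
Variables (K : fieldType) (W : lmodType K).
Variables (gm : {linear W -> W}) (P : W * W -> {linear W -> W}).
Variable (Pi : cochain W 1).
Hypothesis PiE : forall Y x, Pi [ffun=> Y] x = P Y x.

Local Notation bg := (bivmap gm).
Local Notation lcochain := (seq (W * W) -> W -> W).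

Definition del (T : Type) (s : seq T) i := take i s ++ drop i.+1 s.

Lemma nth_del (T : Type) (d : T) s i a : (i <= size s)%N -> nth d (del s i) a = nth d s (bump i a).
Proof.
move=> lei; rewrite /del nth_cat size_takel // /bump ltnNge.
case: leqP => /= ai; first by rewrite nth_drop; congr nth; lia.
by rewrite nth_take.
Qed.

Lemma size_del (T : Type) (s : seq T) i : (i < size s)%N -> size (del s i) = (size s).-1.
Proof. by move=> h; rewrite /del size_cat size_takel ?size_drop; lia. Qed.

Lemma subst_sumE X (phi : lcochain) s x :
  subst_sum gm P X phi s x
  = \sum_(k < size s) act_on gm P X
      (fun Z => phi (take k (map bg s) ++ Z :: drop k.+1 (map bg s)) (gm x))
      (nth 0 s k)
    + phi (map bg s) (P X x).
Proof.
elim: s phi => [|Y s IH] phi /=; first by rewrite big_ord0 add0r.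
by rewrite big_ord_recl /= ?take0 ?drop0 IH addrA.
Qed.

(** Unrolling the recursion: the i-th term has lost its first i bivectors to phi,
and each contraction contributes a sign. *)
Lemma ldiffE m (phi phi' : lcochain) s x :
  ldiff gm P m phi phi' s x
  = \sum_(i < size s) (-1) ^+ i *:
      (lie gm P m (nth 0 s i) (fun t => phi (take i s ++ t))
           (fun t => phi' (map bg (take i s) ++ t)) (drop i.+1 s) x
       + last_term gm P m (nth 0 s i) (fun t => phi (take i s ++ t))
           (drop i.+1 s) x).
Proof.
elim: s phi phi' => [|Y s IH] phi phi' /=; first by rewrite big_ord0.
rewrite big_ord_recl /= ?take0 ?drop0 scale1r IH -sumrN; congr (_ + _).
by apply: eq_bigr => i _; rewrite exprS mulN1r scaleNr.
Qed.

Definition args p (s : seq (W * W)) : {ffun 'I_p -> W * W} := [ffun i : 'I_p => nth 0 s i].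

(** Extending a cochain by 0 to the lists of the wrong length keeps it linear in
each slot, so that the hypotheses of the calculus hold on all lists. *)
Definition hat p (phi : cochain W p) : lcochain :=
  fun s x => if size s == p then phi (args p s) x else 0.

Lemma hatE p (phi : cochain W p) s x : size s = p -> hat phi s x = phi (args p s) x.
Proof. by rewrite /hat => /eqP ->. Qed.

Lemma args_lift p s (i : 'I_p.+1) : size s = p.+1 ->
  [ffun a => args p.+1 s (lift i a)] = args p (del s i).
Proof.
move=> hs; apply/ffunP => a; rewrite !ffunE nth_del //= hs ltnW //.
Qed.

Lemma size_set_at (T : Type) (s : seq T) a Z : (a < size s)%N ->
  size (take a s ++ Z :: drop a.+1 s) = size s.
Proof. by move=> h; rewrite size_cat /= size_takel ?size_drop; lia. Qed.

Lemma args_subst p s (a : 'I_p) Z : size s = p ->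
  subst_arg (args p s) a Z = args p (take a s ++ Z :: drop a.+1 s).
Proof.
move=> hs; apply/ffunP => b; rewrite !ffunE nth_cat size_takel; last by rewrite hs ltnW.
rewrite -val_eqE /=; case: (ltngtP b a) => [h|h|->]; last by rewrite subnn.
  by rewrite nth_take.
by rewrite -(subnSK h) /= nth_drop subnKC.
Qed.

(** With the bracket on the outside, its only bivector X_i is the complement of J.
The first sum of the composition requires all other indices to be smaller than
i, so i is the last index and this sum is [last_term]; the sign is then +1. *)
Lemma circ_degree1_left p (phi : cochain W p) s x : size s = p.+1 ->
  @circ K W gm 1 p p.+1 Pi phi (args p.+1 s) x
  = last_term gm P p (nth 0 s p) (fun t => hat phi (take p s ++ t)) [::] x
    + \sum_(i < p.+1) ((-1) ^+ p * (-1) ^+ i) *: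
        P (bivmap (iter p gm) (nth 0 s i)) (hat phi (del s i) x).
Proof.
move=> hs; rewrite /circ !sum_cardC1; congr (_ + _).
  rewrite (bigD1 ord_max) //= [X in _ + X]big1 ?addr0 => [|i imax].
    rewrite (bigD1 ord0) /=; last by rewrite finset.setCK elt_of_set1 all_setC1_lt.
    rewrite big1 ?addr0; last first.
      by move=> k /andP[_]; rewrite ord1 eqxx.
    rewrite finset.setCK subargs_set1 subargs_setC1 args_lift //.
    rewrite sign_shuffle_setC1 /= -exprD addnn -signr_odd odd_double scale1r.
    have sub1 Y : subst_arg (argmap (iter p gm) [ffun => args p.+1 s ord_max]) ord0 Y
      = [ffun => Y] :> {ffun 'I_1 -> _}.
      by apply/ffunP => a; rewrite !ffunE ord1.
    rewrite !sub1 !PiE !ffunE /= -!hatE ?size_del ?hs //.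
    by rewrite /del drop_oversize ?hs.
  apply: big1 => k; rewrite finset.setCK ord1 elt_of_set1 all_setC1_lt.
  by rewrite (negbTE imax).
apply: eq_bigr => i _.
rewrite sign_shuffle_setC1 finset.setCK subargs_set1 subargs_setC1 args_lift //.
have -> : argmap (iter p gm) [ffun => args p.+1 s i]
  = [ffun => bivmap (iter p gm) (nth 0 s i)] :> {ffun 'I_1 -> _}.
  by apply/ffunP => a; rewrite !ffunE.
by rewrite PiE -hatE // size_del ?hs.
Qed.

(** With the bracket on the inside, J = {i}, and X_i acts on the arguments that
come after it: these two sums of the composition make up one [subst_sum]. *)
Lemma circ_degree1_right p (phi : cochain W p) s x : size s = p.+1 ->
  @circ K W gm p 1 p.+1 phi Pi (args p.+1 s) x
  = \sum_(i < p.+1) (-1) ^+ i *: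
      subst_sum gm P (nth 0 s i) (fun t => hat phi (map bg (take i s) ++ t))
        (drop i.+1 s) x.
Proof.
move=> hs; rewrite /circ !sum_card1 -big_split; apply: eq_bigr => i _ /=.
rewrite sign_shuffle_set1 -scaler_sumr -scalerDr; congr (_ *: _).
rewrite subargs_set1 subargs_setC1 args_lift //.
have nthX : args p.+1 s i = nth 0 s i by rewrite ffunE.
have szd : size (del s i) = p by rewrite size_del hs.
have argmapE : argmap (iter 1 gm) (args p (del s i)) = args p (map bg (del s i)).
  by apply/ffunP => a; rewrite !ffunE (nth_map 0) ?szd.
rewrite subst_sumE size_drop hs subSS nthX PiE argmapE -hatE ?size_map //.
rewrite -map_cat -/(del s i); congr (_ + _).
(* The a-th entry of the list without X_i comes after X_i exactly when i <= a. *)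
pose G a := act_on gm P (nth 0 s i) (fun Z => hat phi
  (take a (map bg (del s i)) ++ Z :: drop a.+1 (map bg (del s i))) (gm x))
  (nth 0 (del s i) a).
transitivity (\sum_(a < p | (i <= a)%N) G a).
  apply: eq_big => [a|a _].
    rewrite all_set1_lt elt_of_setC1 /= /bump.
    by case: (leqP i a) => h; rewrite ?add1n ?ltnS ?h // add0n ltnNge ltnW.
  rewrite /G /act_on !args_subst ?size_map // -!hatE ?size_set_at ?size_map ?szd // !PiE.
  by rewrite !ffunE.
rewrite -(big_geq_mkord i p xpredT G) -{1}[i : nat]add0n big_addn big_mkord.
apply: eq_bigr => k _; rewrite /G.
have szt : size (take i s) = i by rewrite size_takel // hs ltnW.
have -> : nth 0 (del s i) (k + i) = nth 0 (drop i.+1 s) k.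
  by rewrite nth_cat szt ltnNge leq_addl addnK.
rewrite /act_on !map_cat !take_cat !drop_cat !size_map szt.
by rewrite !ltnNge leq_addl leqW ?leq_addl // addnK -addSn addnK -!catA.
Qed.

(** The factor (-1)^p in front of the first composition turns the signs (-1)^(p+i)
into (-1)^i. *)
Lemma bracket3HL_degree1 p (phi : cochain W p) s x : size s = p.+1 ->
  bracket3HL gm Pi phi (args p.+1 s) x = ldiff gm P p (hat phi) (hat phi) s x.
Proof.
move=> hs; rewrite /bracket3HL circ_degree1_left // circ_degree1_right // muln1.
rewrite ldiffE hs; under [RHS]eq_bigr do rewrite scalerDr.
rewrite big_split /= [X in _ = _ + X](bigD1 ord_max) //= [X in _ = _ + (_ + X)]big1.
  rewrite drop_oversize ?hs // scalerDr scaler_sumr addr0 [RHS]addrC -addrA; congr (_ + _).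
  rewrite -sumrB; apply: eq_bigr => i _.
  by rewrite scalerA mulrA -exprD addnn -signr_odd odd_double mul1r /lie scalerBr.
(* The extra term needs an empty remaining list, hence the last index. *)
move=> i imax; have : (i.+1 < size s)%N.
  by rewrite hs ltnS ltn_neqAle -val_eqE /= in imax *; rewrite imax -ltnS ltn_ord.
by move/(drop_nth 0) => ->; rewrite scaler0.
Qed.

Hypothesis biv_P : forall x, bivector_fun (fun Y => P Y x).

Lemma hat_bracket3HL p (phi : cochain W p) s x :
  hat (bracket3HL gm Pi phi : cochain W p.+1) s x = ldiff gm P p (hat phi) (hat phi) s x.
Proof.
rewrite {1}/hat; case: eqP => [|/eqP] hs; first exact: bracket3HL_degree1.
by symmetry; apply: supported_ldiff hs => // t y ht; rewrite /hat (negbTE ht).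
Qed.

Lemma hat_codom p (phi : cochain W p) X x : phi X x = hat phi (codom X) x.
Proof.
rewrite hatE ?size_codom ?card_ord //; congr phi.
by apply/ffunP => i; rewrite ffunE (nth_map i) ?size_enum_ord // nth_ord_enum.
Qed.

Lemma hat_subst p (phi : cochain W p) X i Y x : phi (subst_arg X i Y) x
  = hat phi (take i (codom X) ++ Y :: drop i.+1 (codom X)) x.
Proof.
have sz : size (codom X) = p by rewrite size_codom card_ord.
rewrite hatE ?size_set_at ?sz // -args_subst //; congr (phi (subst_arg _ _ _) _).
by apply/ffunP => k; rewrite ffunE (nth_map k) ?size_enum_ord // nth_ord_enum.
Qed.

Lemma argmap_args p s : size s = p -> argmap gm (args p s) = args p (map bg s).
Proof. by move=> hs; apply/ffunP => a; rewrite !ffunE (nth_map 0) ?hs. Qed.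

Lemma multilinear_hat p (phi : cochain W p) :
  hom_cochain gm phi -> multilinear (hat phi).
Proof.
move=> h; split=> [s1 s2 x|s].
  have [hs|/eqP hs] := eqVneq (size s1 + (size s2).+1)%N p; last first.
    have e : (fun Y => hat phi (s1 ++ Y :: s2) x) = (fun=> 0).
      by apply: funext => Y; rewrite /hat size_cat /=; case: eqP.
    by rewrite e; exact: biv0.
  have lts : (size s1 < p)%N by lia.
  have e Y : hat phi (s1 ++ Y :: s2) x
             = phi (subst_arg (args p (s1 ++ 0 :: s2)) (Ordinal lts) Y) x.
    rewrite args_subst /= ?size_cat // take_size_cat // hatE ?size_cat //.
    by rewrite drop_cat ltnNge leqnSn subSn // subnn /= drop0.
  split=> [y a u v|y z]; rewrite !e.
    exact: (hc_linear_fst h).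
  exact: (hc_skew h).
move=> a u v; rewrite /hat; case: eqP => _; first exact: (hc_linear h).
by rewrite scaler0 addr0.
Qed.

Lemma skew_last_hat p (phi : cochain W p) :
  hom_cochain gm phi -> skew_last (hat phi).
Proof.
move=> h s y z x; have [hs|/eqP hs] := eqVneq (size s).+1 p; last first.
  by rewrite /hat !size_rcons; case: eqP; rewrite ?oppr0.
have lts : (size s < p)%N by lia.
have e Y w : hat phi (rcons s Y) w
           = phi (subst_arg (args p (rcons s 0)) (Ordinal lts) Y) w.
  rewrite args_subst /= ?size_rcons // hatE ?size_rcons // -!cats1 take_size_cat //.
  by rewrite drop_oversize ?size_cat ?addn1.
by rewrite !e (hc_skew_last h).
Qed.

Lemma intertwined_hat p (phi : cochain W p) :
  hom_cochain gm phi -> intertwined gm (hat phi) (hat phi).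
Proof.
move=> h s x; rewrite /hat size_map; case: eqP => hs; last exact: linear0.
by rewrite (hc_gamma h) argmap_args.
Qed.

Lemma hom_cochain_of_hat p (phi : cochain W p) :
  multilinear (hat phi) -> skew_last (hat phi) ->
  intertwined gm (hat phi) (hat phi) -> hom_cochain gm phi.
Proof.
move=> h hs he; split=> [X i y x a u v|X i y x a u v|X a u v|X i y z x|X i y z x ip|X x].
- by rewrite !hat_subst (biv_linear (ml_biv h _ _ _)).
- by rewrite !hat_subst (biv_linear2 (ml_biv h _ _ _)).
- by rewrite !hat_codom (ml_linear h).
- by rewrite !hat_subst (biv_skew (ml_biv h _ _ _)).
- have sz : size (codom X) = p by rewrite size_codom card_ord.
  by rewrite !hat_subst ip drop_oversize ?sz // !cats1 hs.
- rewrite !hat_codom he; congr (hat phi _ _).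
  by rewrite /codom /image_mem -map_comp; apply: eq_map => k; rewrite /= ffunE.
Qed.

End Translation.

(** * The differential of a cochain of degree one with square zero *)

Definition pack_linear (K : fieldType) (U : lmodType K) (f : U -> U) (hf : linear f) :
    {linear U -> U} := HB.pack f (GRing.isLinear.Build K U U *:%R f hf).

Section Differential.
Variables (K : fieldType) (W : lmodType K).
Variables (gamma : W -> W) (Pi : cochain W 1).
Hypotheses (gamma_linear : linear gamma) (Pi_cochain : hom_cochain gamma Pi).

Local Notation gm := (pack_linear gamma_linear).
Local Notation P :=
  (fun Y => pack_linear (hc_linear Pi_cochain [ffun=> Y])).

Lemma PiE Y x : Pi [ffun=> Y] x = P Y x. Proof. by []. Qed.

Lemma hat_Pi Y x : hat Pi [:: Y] x = P Y x.
Proof. by rewrite hatE //= ; congr Pi; apply/ffunP => i; rewrite !ffunE ord1. Qed.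

Lemma P_biv x : bivector_fun (fun Y => P Y x).
Proof.
have := ml_biv (multilinear_hat (gm := gm) Pi_cochain) [::] [::] x.
by congr bivector_fun; apply: funext => Y; rewrite hat_Pi.
Qed.

Lemma P_gm Y x : gm (P Y x) = P (bivmap gm Y) (gm x).
Proof. by rewrite -!hat_Pi (intertwined_hat (gm := gm) Pi_cochain). Qed.

Lemma P_skew y z x : P (y, z) x = - P (y, x) z.
Proof. by rewrite -!hat_Pi (skew_last_hat (gm := gm) Pi_cochain [::]). Qed.

Lemma hat_bracket p (phi : cochain W p) s x :
  hat (bracket3HL gamma Pi phi : cochain W p.+1) s x
  = ldiff gm P p (hat phi) (hat phi) s x.
Proof. exact: (hat_bracket3HL gm PiE P_biv). Qed.

Lemma hom_cochain_bracket p (phi : cochain W p) :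
  hom_cochain gamma phi -> hom_cochain gamma (bracket3HL gamma Pi phi : cochain W p.+1).
Proof.
move=> h; have e := hat_bracket phi.
have {}e : hat (bracket3HL gamma Pi phi : cochain W p.+1)
         = ldiff gm P p (hat phi) (hat phi) by apply/funext => s; apply/funext => x.
have hm := multilinear_hat (gm := gm) h.
have hi := intertwined_hat (gm := gm) h.
apply: (hom_cochain_of_hat (gm := gm)); rewrite e.
- exact: (multilinear_ldiff gm P_biv).
- have hs := skew_last_hat (gm := gm) h.
  exact: (skew_last_ldiff gm P_skew p hm hs hs).
- exact: (intertwined_ldiff P_gm p hi hi).
Qed.

Hypothesis two_neq0 : 2%:R != 0 :> K.
Hypothesis Pi_square : forall X x, bracket3HL gamma Pi Pi X x = 0.

(** At two bivectors X, Y, the value of [Pi, Pi] is twice the defect of the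
fundamental identity. *)
Lemma P_fundamental X Y x : P (bivmap gm X) (P Y x)
  = act_on gm P X (fun Z => P Z (gm x)) Y + P (bivmap gm Y) (P X x).
Proof.
have := hat_bracket Pi [:: X; Y] x.
rewrite hatE // Pi_square /= /lie /= /act_on /= /ins !hat_Pi.
move=> e; apply/eqP; rewrite -subr_eq0; apply/eqP.
have /eqP : 2%:R *: (P (bivmap gm X) (P Y x)
  - (act_on gm P X (fun Z => P Z (gm x)) Y + P (bivmap gm Y) (P X x))) = 0.
  by rewrite scaler_nat mulr2n [RHS]e /act_on; zmod_eq.
by rewrite scaler_eq0 (negbTE two_neq0) => /eqP.
Qed.

Lemma bracket_square p (phi : cochain W p) X x : hom_cochain gamma phi ->
  bracket3HL gamma Pi (bracket3HL gamma Pi phi : cochain W p.+1) X x = 0.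
Proof.
move=> h; have hi := intertwined_hat (gm := gm) h.
rewrite (@hat_codom K W p.+2 (bracket3HL gamma Pi (bracket3HL gamma Pi phi : cochain W p.+1))).
rewrite hat_bracket.
rewrite (ldiff_ext gm P p.+1 (hat_bracket phi) (hat_bracket phi)).
exact: (ldiff_square P_biv P_gm P_fundamental p _ _ hi hi (multilinear_hat (gm := gm) h)).
Qed.

End Differential.

(** * The bracket of a generalized representation *)

Section SemidirectBracket.
Variables (K : fieldType) (g V : lmodType K).
Variables (br : g -> g -> g -> g) (alpha : g -> g).
Variables (rho : g -> g -> V -> V) (nu : g -> V -> V -> V) (A : V -> V).
Hypotheses (charK : [pchar K] =i pred0) (hg : three_hom_lie br alpha).
Hypothesis (hV : generalized_rep br alpha rho nu A).

Local Notation W := (g * V)%type.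
Local Notation gamma := (sum_map alpha A).
Local Notation Pi := (total_bracket br rho nu).

Lemma sum_map_linear : linear gamma.
Proof.
by move=> a u v; rewrite /sum_map /= (thl_linear hg) (gr_linear hV).
Qed.

Local Notation gm := (pack_linear sum_map_linear).
Local Notation P :=
  (fun Y => pack_linear (hc_linear (gr_cochain hV) [ffun=> Y])).

Lemma br0l y z : br 0 y z = 0.
Proof. exact: (linear_zero (trilinear1 (thl_trilinear hg) y z)). Qed.
Lemma br0m y z : br y 0 z = 0.
Proof. exact: (linear_zero (trilinear2 (thl_trilinear hg) y z)). Qed.
Lemma br0r y z : br y z 0 = 0.
Proof. exact: (linear_zero (trilinear3 (thl_trilinear hg) y z)). Qed.

(** Each of pi, rho-bar and nu-bar has at least one argument in the Lie algebra
summand, so V is abelian for the total bracket. *)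
Lemma total_bracket_V (Y : W * W) (x : W) :
  Y.1.1 = 0 -> Y.2.1 = 0 -> x.1 = 0 -> Pi [ffun=> Y] x = 0.
Proof.
rewrite /total_bracket !ffunE => -> -> ->.
have r0 y u : rho 0 y u = 0 := linear_zero (trilinear1 (gr_rho_trilinear hV) y u).
have n0 u v : nu 0 u v = 0 := linear_zero (trilinear1 (gr_nu_trilinear hV) u v).
by rewrite br0l !r0 !n0 !addr0.
Qed.

Lemma two_neq0 : 2%:R != 0 :> K.
Proof. by have := charK 2; rewrite !inE /= => /negbT. Qed.

Lemma hat_hom_diff p (phi : cochain W p) s x :
  hat (hom_diff br alpha rho nu A phi) s x
  = ldiff gm P p (hat phi) (hat phi) s x.
Proof. exact: hat_bracket. Qed.

Lemma hom_diff_linear p a (phi psi : cochain W p) :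
  hom_diff br alpha rho nu A (a *: phi + psi)
  = a *: hom_diff br alpha rho nu A phi + hom_diff br alpha rho nu A psi.
Proof.
apply: funext => X; apply: funext => x.
change (hom_diff br alpha rho nu A (a *: phi + psi) X x =
 a *: hom_diff br alpha rho nu A phi X x + hom_diff br alpha rho nu A psi X x).
rewrite !hat_codom !hat_hom_diff -(ldiffP gm (P_biv sum_map_linear (gr_cochain hV))).
have e s y : hat (a *: phi + psi) s y = a *: hat phi s y + hat psi s y.
  by rewrite /hat; case: eqP => // _; rewrite scaler0 addr0.
exact: ldiff_ext.
Qed.

Lemma tilde_hom_diff p (phi : cochain W p) : tilde_cochain alpha A phi ->
  tilde_cochain alpha A (hom_diff br alpha rho nu A phi).
Proof.
move=> [[hphi Vphi] vphi]; split; first split.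
- exact: (hom_cochain_bracket sum_map_linear (gr_cochain hV)).
- move=> X w; rewrite hat_codom hat_hom_diff.
  have hN s x : (hat phi s x).1 = 0 by rewrite /hat; case: eqP => // _; rewrite Vphi.
  apply: (@ldiff_ideal K W gm P (fun w : W => w.1 = 0)) => //.
  + by move=> u v /= -> ->; rewrite addr0.
  + by move=> u /= ->; rewrite oppr0.
  + by move=> Y x /= ->; rewrite br0r.
  + by move=> y z x hy; rewrite /= !ffunE /= hy br0l.
  + by move=> y z x hz; rewrite /= !ffunE /= hz br0m.
move=> X w hX hw; rewrite hat_codom hat_hom_diff.
have hv : vanishes_on (fun w : W => w.1 = 0) (hat phi).
  move=> s x hs hx; rewrite /hat; case: eqP => // sz; apply: vphi => // i.
  by rewrite !ffunE; apply: hs; rewrite mem_nth // sz.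
apply: (@vanishes_ldiff K W gm P (P_biv sum_map_linear (gr_cochain hV)) (fun w : W => w.1 = 0)) => //.
- by move=> u /= ->; exact: linear_zero (thl_linear hg).
- by move=> y z x hy hz hx; apply: total_bracket_V.
- by move=> Y /codomP[i ->]; apply: hX.
Qed.

Lemma hom_diff_square p (phi : cochain W p) : tilde_cochain alpha A phi ->
  hom_diff br alpha rho nu A (hom_diff br alpha rho nu A phi) = 0.
Proof.
move=> [[hphi _] _]; apply: funext => X; apply: funext => x.
exact: (bracket_square sum_map_linear (gr_cochain hV) two_neq0 (gr_bracket hV)).
Qed.

Lemma tilde_zero p : tilde_cochain alpha A (0 : cochain W p).
Proof.
have e X x : (0 : cochain W p) X x = 0 by [].
split; first split.
- split=> [X i y x b u v|X i y x b u v|X b u v|X i y z x|X i y z x _|X x];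
  by rewrite !e ?scaler0 ?addr0 ?oppr0 // (linear_zero sum_map_linear).
- by move=> X w; rewrite e.
by move=> X w _ _; rewrite e.
Qed.

Lemma tilde_subspace p a (phi psi : cochain W p) : tilde_cochain alpha A phi ->
  tilde_cochain alpha A psi -> tilde_cochain alpha A (a *: phi + psi).
Proof.
have e X x : (a *: phi + psi : cochain W p) X x = a *: phi X x + psi X x by [].
move=> [[h Vh] vh] [[h' Vh'] vh']; split; first split.
- split.
  + move=> X i y x b u v; rewrite !e (hc_linear_fst h) (hc_linear_fst h').
    by rewrite !scalerDr !scalerA (mulrC a); zmod_eq.
  + move=> X i y x b u v; rewrite !e (hc_linear_snd h) (hc_linear_snd h').
    by rewrite !scalerDr !scalerA (mulrC a); zmod_eq.
  + move=> X b u v; rewrite !e (hc_linear h) (hc_linear h').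
    by rewrite !scalerDr !scalerA (mulrC a); zmod_eq.
  + by move=> X i y z x; rewrite !e (hc_skew h) (hc_skew h') scalerN opprD.
  + by move=> X i y z x ip; rewrite !e (hc_skew_last h) // (hc_skew_last h') // scalerN opprD.
  + by move=> X x; rewrite !e sum_map_linear (hc_gamma h) (hc_gamma h').
- by move=> X w; rewrite e /= Vh Vh' scaler0 addr0.
by move=> X w hX hw; rewrite e vh // vh' // scaler0 addr0.
Qed.

End SemidirectBracket.

Theorem theorem3p1 (K : fieldType) (charK : [pchar K] =i pred0)
    (g V : lmodType K)
    (br : g -> g -> g -> g) (alpha : g -> g)
    (rho : g -> g -> V -> V) (nu : g -> V -> V -> V) (A : V -> V)
    (hg : three_hom_lie br alpha)
    (hV : generalized_rep br alpha rho nu A) :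
  (forall (p : nat) (phi : cochain (g * V)%type p),
     tilde_cochain alpha A phi ->
     tilde_cochain alpha A (hom_diff br alpha rho nu A phi) /\
     hom_diff br alpha rho nu A (hom_diff br alpha rho nu A phi) = 0) /\
  cochain_complex_from1
    (T := fun p : nat => cochain (g * V)%type p.-1)
    (@complex_space K g V alpha A)
    (@complex_diff K g V br alpha rho nu A).
Proof.
have tilde_d := tilde_hom_diff hg hV.
have square_d := hom_diff_square charK hg hV.
split=> [p phi hphi|]; first by split; [exact: tilde_d | exact: square_d].
split=> [] [//|p] _.
- exact: tilde_zero hg hV p.
- exact: tilde_subspace hg hV p.
- exact: tilde_d.
- by move=> a x y _ _; apply: hom_diff_linear.
- exact: square_d.
Qed.
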